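(* Fix a surrogate model $m$, an iteration $t$ and a candidate $\lambda\in\Lambda$. Let $q_{m,t}$ be a probability density on $\Theta\subseteq\mathbb{R}^{d_\theta}$, differentiable on its support $\Theta$, with $\int_\Theta \nabla_\theta q_{m,t}(\theta)\,d\theta=0$, and let $g(\theta):=\nabla_\theta\log q_{m,t}(\theta)$. Assume that $\mathbb{E}_{\theta\sim q_{m,t}}[\mathrm{EI}_m(\lambda;\theta)^2]<\infty$, that $\mathbb{E}_{\theta\sim q_{m,t}}[\|g(\theta)\|_2^2]<\infty$, and that $\Sigma_g:=\operatorname{Cov}_{q_{m,t}}(g,g)$ is nonsingular. Define $$\mathrm{EI}_m^{\mathrm{orth}}(\lambda;\theta):=\mathrm{EI}_m(\lambda;\theta)-\gamma_m(\lambda)^\top g(\theta),\qquad \gamma_m(\lambda):=\Sigma_g^{-1}\operatorname{Cov}_{q_{m,t}}\big(g,\mathrm{EI}_m(\lambda;\cdot)\big).$$ Then: (i) $\mathbb{E}_{\theta\sim q_{m,t}}\big[\mathrm{EI}_m^{\mathrm{orth}}(\lambda;\theta)\big]=\mathrm{EI}_m^{\mathrm{marg}}(\lambda)$. (ii) With variances and covariances taken under $\theta\sim q_{m,t}$, $$\operatorname{Var}\big(\mathrm{EI}_m^{\mathrm{orth}}(\lambda;\theta)\big)=\operatorname{Var}\big(\mathrm{EI}_m(\lambda;\theta)\big)-\operatorname{Cov}\big(g,\mathrm{EI}_m(\lambda;\cdot)\big)^\top\Sigma_g^{-1}\operatorname{Cov}\big(g,\mathrm{EI}_m(\lambda;\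cdot)\big)\le\operatorname{Var}\big(\mathrm{EI}_m(\lambda;\theta)\big).$$
   Context: $\Lambda\subseteq\mathbb{R}^d$ is a search space. The data at iteration $t$ are $\mathcal{D}_t=\{(\lambda_i,y_i)\}_{i=1}^t$ with $\lambda_i\in\Lambda$, $y_i\in\mathbb{R}$, and $f^\star=\min_{i\le t}y_i$. A surrogate model $m$ has a parameter $\theta\in\Theta\subseteq\mathbb{R}^{d_\theta}$; for each $\theta$ it specifies a predictive distribution of the random value $f(\lambda)$ given $\mathcal{D}_t$ and $\theta$. The expected improvement is $\mathrm{EI}_m(\lambda;\theta)=\mathbb{E}[(f^\star-f(\lambda))_+\mid\mathcal{D}_t,\theta]$ with $(x)_+=\max\{0,x\}$, regarded as a real-valued measurable function of $\theta$. The (approximate) posterior over parameters is a probability density $q_{m,t}$ on $\Theta$, positive on $\Theta$ (so that $\log q_{m,t}$ is defined). The marginal EI is $\mathrm{EI}_m^{\mathrm{marg}}(\lambda)=\mathbb{E}_{\theta\sim q_{m,t}}[\mathrm{EI}_m(\lambda;\theta)]$. $\operatorname{Cov}_{q_{m,t}}(g,g)\in\mathbb{R}^{d_\theta\times d_\theta}$ is the covariance matrix of $g(\theta)$, and $\operatorname{Cov}_{q_{m,t}}(g,h)\in\mathbb{R}^{d_\theta}$, for scalar $h$, is the vector with entries $\operatorname{Cov}(g_j(\theta),h(\theta))$, $\theta\sim q_{m,t}$. *)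

(* Defs.v *)
From HB Require Import structures.
From mathcomp Require Import all_boot all_order all_algebra.
From mathcomp Require Import all_classical all_reals all_analysis.
From mathcomp Require Import measurable_realfun.

Set Implicit Arguments.
Unset Strict Implicit.
Unset Printing Implicit Defensive.

Import Order.TTheory GRing.Theory Num.Theory.
Import numFieldNormedType.Exports.

Local Open Scope classical_set_scope.
Local Open Scope ring_scope.

(* MathComp-Analysis provides neither a sigma-algebra nor a Lebesgue measure on
   the normed space ['rV[R]_n].  Both are built here.  The sigma-algebra is the
   one generated by the coordinates, i.e. the Borel sigma-algebra of R^n. *)

Definition measure_rV_display : measure_display.
Proof. exact: default_measure_display. Qed.

Section measurable_rV.
Context {R : realType} {n : nat}.

Let coors : 'I_n -> 'rV[R]_n -> R := fun i x => x ord0 i.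

Let rV_set0 : g_sigma_preimage coors set0.
Proof. exact: sigma_algebra0. Qed.

Let rV_setC A : g_sigma_preimage coors A -> g_sigma_preimage coors (~` A).
Proof. exact: sigma_algebraC. Qed.

Let rV_bigcup (F : (set 'rV[R]_n)^nat) :
  (forall i, g_sigma_preimage coors (F i)) ->
  g_sigma_preimage coors (\bigcup_i (F i)).
Proof. exact: sigma_algebra_bigcup. Qed.

HB.instance Definition _ := @isMeasurable.Build measure_rV_display
  'rV[R]_n (g_sigma_preimage coors) rV_set0 rV_setC rV_bigcup.

End measurable_rV.

Lemma measurable_coord (R : realType) n (i : 'I_n) :
  measurable_fun [set: 'rV[R]_n] (fun x : 'rV[R]_n => x ord0 i).
Proof.
move=> _ Y mY; rewrite setTI; apply: sub_sigma_algebra => /=.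
rewrite -bigcup_seq/=; exists i => /=; first by rewrite mem_index_enum.
by exists Y => //; rewrite setTI.
Qed.

Lemma measurable_fun_rVP d (T : measurableType d) (R : realType) n
    (f : T -> 'rV[R]_n) :
  measurable_fun [set: T] f <->
  forall i, measurable_fun [set: T] (fun t => f t ord0 i).
Proof.
split=> [mf i|mf].
  exact: (measurableT_comp (measurable_coord i) mf).
move=> _; pose coors (i : 'I_n) (x : 'rV[R]_n) := x ord0 i.
have -> : measurable = g_sigma_preimage coors by [].
suff : preimage_set_system [set: T] f (g_sigma_preimage coors) `<=` measurable.
  by move=> H Y mY; apply: H; exists Y.
rewrite -(g_sigma_preimage_comp coors f).
apply: smallest_sub; first exact: sigma_algebra_measurable.
rewrite -bigcup_seq; apply: bigcup_sub => i _.
by move=> A [B mB <-]; exact: mf.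
Qed.

Section cons_rV.
Context {R : realType} {n : nat}.

Definition cons_rV (x : R * 'rV[R]_n) : 'rV[R]_n.+1 :=
  \row_i (if unlift ord0 i is Some j then x.2 ord0 j else x.1).

Definition uncons_rV (x : 'rV[R]_n.+1) : R * 'rV[R]_n :=
  (x ord0 ord0, \row_j x ord0 (lift ord0 j)).

Lemma cons_rVK : cancel cons_rV uncons_rV.
Proof.
move=> [a x]; rewrite /uncons_rV /cons_rV mxE unlift_none /=; congr pair.
by apply/rowP => j; rewrite !mxE liftK.
Qed.

Lemma measurable_cons_rV : measurable_fun [set: R * 'rV[R]_n] cons_rV.
Proof.
apply/measurable_fun_rVP => i; rewrite /cons_rV.
under eq_fun do rewrite mxE.
case: (unlift ord0 i) => [j|]; last exact: measurable_fst.
exact: (measurableT_comp (measurable_coord j) measurable_snd).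
Qed.

Lemma measurable_uncons_rV : measurable_fun [set: 'rV[R]_n.+1] uncons_rV.
Proof.
apply/measurable_fun_pairP; split; first exact: measurable_coord.
apply/measurable_fun_rVP => i.
rewrite (_ : (fun _ => _) = fun x : 'rV[R]_n.+1 => x ord0 (lift ord0 i)).
  exact: measurable_coord.
by apply/funext => x /=; rewrite mxE.
Qed.

End cons_rV.

Section lebesgue_cons.
Local Open Scope ereal_scope.
Context {R : realType} {n : nat}.
Variable mu : {sigma_finite_measure set 'rV[R]_n -> \bar R}.

Definition lebesgue_cons : set 'rV[R]_n.+1 -> \bar R :=
  pushforward ((@lebesgue_measure R) \x mu) cons_rV.

Let mcons := measurable_cons_rV (R := R) (n := n).

Let lebesgue_cons0 : lebesgue_cons set0 = 0.
Proof. by rewrite /lebesgue_cons /pushforward preimage_set0 measure0. Qed.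

Let lebesgue_cons_ge0 A : 0 <= lebesgue_cons A.
Proof. exact: measure_ge0. Qed.

Let lebesgue_cons_sigma_additive : semi_sigma_additive lebesgue_cons.
Proof.
exact: (@measure_semi_sigma_additive _ _ _
  (measure_function_pushforward__canonical__measure_function_Measure
    ((@lebesgue_measure R) \x mu) mcons)).
Qed.

HB.instance Definition _ := isMeasure.Build _ _ _ lebesgue_cons
  lebesgue_cons0 lebesgue_cons_ge0 lebesgue_cons_sigma_additive.

Let lebesgue_consX (A : set R) (B : set 'rV[R]_n) :
  measurable A -> measurable B ->
  lebesgue_cons (uncons_rV @^-1` (A `*` B)) = lebesgue_measure A * mu B.
Proof.
move=> mA mB; rewrite /lebesgue_cons /pushforward -comp_preimage.
rewrite (_ : _ \o _ = id) ?preimage_id; first exact: product_measure1E.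
by apply/funext => x /=; rewrite cons_rVK.
Qed.

Let lebesgue_cons_sigma_finite : sigma_finite setT lebesgue_cons.
Proof.
have /sigma_finiteP[F [TF ndF Foo]] := sigma_finiteT (@lebesgue_measure R).
have /sigma_finiteP[G [TG ndG Goo]] := sigma_finiteT mu.
exists (fun k => uncons_rV @^-1` (F k `*` G k)).
  rewrite -preimage_bigcup (_ : \bigcup_k _ = setT) ?preimage_setT//.
  rewrite -subTset => -[x y] _.
  have [i _ Fx] : (\bigcup_i F i) x by rewrite -TF.
  have [j _ Gy] : (\bigcup_j G j) y by rewrite -TG.
  exists (maxn i j) => //; split.
  - by move: x Fx; exact/subsetPset/ndF/leq_maxl.
  - by move: y Gy; exact/subsetPset/ndG/leq_maxr.
move=> k; have [mF Fk] := Foo k; have [mG Gk] := Goo k; split.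
  rewrite -[X in measurable X]setTI; apply: measurable_uncons_rV => //.
  exact: measurableX.
by rewrite lebesgue_consX// lte_mul_pinfty// ge0_fin_numE.
Qed.

HB.instance Definition _ := Measure_isSigmaFinite.Build _ _ _ lebesgue_cons
  lebesgue_cons_sigma_finite.

End lebesgue_cons.

(* [R^0] is a single point, of measure 1. *)
Fixpoint lebesgue_rV (R : realType) (n : nat) :
    {sigma_finite_measure set 'rV[R]_n -> \bar R} :=
  if n is n'.+1 then lebesgue_cons (lebesgue_rV R n')
  else \d_(0 : 'rV[R]_0).

Lemma lebesgue_rV_box (R : realType) n (A : 'I_n -> set R) :
  (forall i, measurable (A i)) ->
  lebesgue_rV R n [set x | forall i, A i (x ord0 i)] =
  (\prod_(i < n) @lebesgue_measure R (A i))%E.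
Proof.
elim: n A => [|n IH] A mA.
  rewrite big_ord0 /= diracE mem_set//=; by case.
rewrite big_ord_recl -IH//= /lebesgue_cons /pushforward.
set B := [set x : 'rV[R]_n | forall i, A (lift ord0 i) (x ord0 i)].
have mB : measurable B.
  rewrite (_ : B = \bigcap_(i in [set: 'I_n])
      ((fun x : 'rV[R]_n => x ord0 i) @^-1` A (lift ord0 i))).
    apply: fin_bigcap_measurable => // i _.
    by rewrite -[X in measurable X]setTI; exact: measurable_coord.
  by apply/seteqP; split=> x /= H i; [move=> _; exact: H|exact: H].
rewrite -product_measure1E//; last exact: mA.
congr (_ _); apply/seteqP; split=> [[a x]/= H|[a x]/= [Ha Hx] i].
  split; first by have := H ord0; rewrite mxE unlift_none.
  by move=> i; have := H (lift ord0 i); rewrite mxE liftK.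
by rewrite mxE; case: unliftP => [j ->|->].
Qed.

Section gradient.
Context {R : realType} {n : nat}.

Definition gradient (f : 'rV[R]_n -> R) (x : 'rV[R]_n) : 'cV[R]_n :=
  \col_j 'D_(delta_mx ord0 j) f x.

(* The library norm on matrices is the sup norm. *)
Definition sqnorm2 (v : 'cV[R]_n) : R := \sum_j v j ord0 ^+ 2.

End gradient.

(* A probability density on [Theta], given as a function on the whole space so
   that it can be differentiated at every point of [Theta]; its values outside
   [Theta] carry no mass and need not be zero. *)
Record density (R : realType) (n : nat) (Theta : set 'rV[R]_n) := Density {
  pdf :> 'rV[R]_n -> R ;
  density_measurable_support : measurable Theta ;
  density_measurable : measurable_fun [set: 'rV[R]_n] pdf ;
  density_gt0 : forall theta, Theta theta -> 0 < pdf theta ;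
  density_integral1 : (\int[lebesgue_rV R n]_(theta in Theta)
    (pdf theta)%:E = 1)%E }.

Section law.
Local Open Scope ereal_scope.
Context {R : realType} {n : nat} {Theta : set 'rV[R]_n}.
Variable q : density Theta.

Definition law (A : set 'rV[R]_n) : \bar R :=
  \int[lebesgue_rV R n]_(theta in A `&` Theta) (q theta)%:E.

Let law0 : law set0 = 0.
Proof. by rewrite /law set0I integral_set0. Qed.

Let law_ge0 A : 0 <= law A.
Proof.
by apply: integral_ge0 => x [_ Tx]; rewrite lee_fin ltW// density_gt0.
Qed.

Let law_sigma_additive : semi_sigma_additive law.
Proof.
move=> F mF tF mUF; rewrite /law setI_bigcupl.
have mT := density_measurable_support q.
rewrite ge0_integral_bigcup//=.
- apply: is_cvg_ereal_nneg_natsum_cond => k _ _; exact: law_ge0.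
- by move=> k; exact: measurableI.
- by apply/measurable_EFinP; apply: measurable_funTS; exact: density_measurable.
- by move=> x [k _ [_ Tx]]; rewrite lee_fin ltW// density_gt0.
- exact: trivIset_setIr.
Qed.

HB.instance Definition _ := isMeasure.Build _ _ _ law
  law0 law_ge0 law_sigma_additive.

Let law_setT : law setT = 1.
Proof. by rewrite /law setTI density_integral1. Qed.

HB.instance Definition _ := Measure_isProbability.Build _ _ _ law law_setT.

End law.

(* Quantities that only make sense for parameters in [Theta] are extended by
   zero to the whole space, on which [law q] lives (and gives mass 0 to the
   complement of [Theta]). *)
Definition score (R : realType) (n : nat) (Theta : set 'rV[R]_n)
    (q : density Theta) (theta : 'rV[R]_n) : 'cV[R]_n :=
  if theta \in Theta then gradient (fun x => ln (q x)) theta else 0.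

Section covariances.
Context {R : realType} {n : nat} (P : probability 'rV[R]_n R).

Definition cov_mx (g : 'rV[R]_n -> 'cV[R]_n) : 'M[R]_n :=
  \matrix_(i, j) fine
    (covariance P (fun x => g x i ord0) (fun x => g x j ord0)).

Definition cov_vec (g : 'rV[R]_n -> 'cV[R]_n) (h : 'rV[R]_n -> R) : 'cV[R]_n :=
  \col_j fine (covariance P (fun x => g x j ord0) h).

End covariances.

(* [predictive m D theta lambda] is the distribution of [f lambda] given the
   data [D] and the parameter [theta]; it is only meaningful when [theta] is
   in [param_space m]. *)
Record surrogate (R : realType) (d n : nat) := Surrogate {
  param_space : set 'rV[R]_n ;
  predictive : seq ('rV[R]_d * R) -> 'rV[R]_n -> 'rV[R]_d -> probability R R }.

Section expected_improvement.
Context {R : realType} {d n : nat}.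
Variables (m : surrogate R d n) (D : seq ('rV[R]_d * R)) (lambda : 'rV[R]_d).

(* The default value of [head] is irrelevant for nonempty data. *)
Definition best_value : R :=
  let ys := [seq p.2 | p <- D] in \big[Num.min/head 0 ys]_(y <- ys) y.

Definition improvement (y : R) : R := Num.max 0 (best_value - y).

Definition EI_ereal (theta : 'rV[R]_n) : \bar R :=
  'E_(predictive m D theta lambda)[improvement].

Definition EI (theta : 'rV[R]_n) : R :=
  if theta \in param_space m then fine (EI_ereal theta) else 0.

Variable q : density (param_space m).

Definition EI_marg : \bar R := 'E_(law q)[EI].

Definition EI_gamma : 'cV[R]_n :=
  invmx (cov_mx (law q) (score q)) *m cov_vec (law q) (score q) EI.

Definition EI_orth (theta : 'rV[R]_n) : R :=
  EI theta - (EI_gamma^T *m score q theta) ord0 ord0.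

End expected_improvement.

(* Main.v *)
(* The score has mean zero, since q * grad (ln q) = grad q integrates to 0, so
   the correction gamma^T g leaves the expectation unchanged.  With
   gamma = Sigma^-1 Cov(g, EI), it is the least-squares regression of EI on g:
   Var(gamma^T g) and Cov(gamma^T g, EI) are both
   Cov(g, EI)^T Sigma^-1 Cov(g, EI).  Expanding Var(EI - gamma^T g) gives the
   formula, and the subtracted term is a variance, hence nonnegative. *)
Require Import Defs.
From mathcomp Require Import all_boot all_order all_algebra.
From mathcomp Require Import all_classical all_reals all_analysis.
From mathcomp Require Import measurable_realfun.

Set Implicit Arguments.
Unset Strict Implicit.
Unset Printing Implicit Defensive.

Import Order.TTheory GRing.Theory Num.Theory.
Import numFieldNormedType.Exports.

Local Open Scope classical_set_scope.
Local Open Scope ring_scope.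

(** * Calculus of the logarithm; criteria for measurability and square integrability *)

Lemma differentiable_ln_comp (R : realType) (V : normedModType R)
    (f : V -> R) (a : V) :
  differentiable f a -> 0 < f a -> differentiable (fun x => ln (f x)) a.
Proof.
move=> df /is_derive1_ln[/derivable1_diffP dln _].
exact: (differentiable_comp df dln).
Qed.

Lemma derive_ln_comp (R : realType) (V : normedModType R)
    (f : V -> R) (a v : V) :
  differentiable f a -> 0 < f a ->
  'D_v (fun x => ln (f x)) a = 'D_v f a / f a.
Proof.
move=> df fa0; rewrite (deriveE _ df) deriveE; last first.
  exact: differentiable_ln_comp.
have [/derivable1_diffP dln lnE] := is_derive1_ln fa0.
rewrite (_ : (fun x => ln (f x)) = @ln R \o f)// diff_comp//=.
(* In dimension one the differential of [ln] is multiplication by its derivative, the inverse of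
   [f a]. *)
by have := congr1 (@^~ ('d f a v)) (diff1E dln); rewrite derive1E lnE.
Qed.

(** The derivative is the pointwise limit of the difference quotients with steps 1/(k+1), which are
    measurable. *)
Lemma measurable_fun_derive (R : realType) n (f : 'rV[R]_n -> R)
    (D : set 'rV[R]_n) (v : 'rV[R]_n) :
  measurable_fun [set: 'rV[R]_n] f ->
  (forall x, D x -> derivable f x v) ->
  measurable_fun D ('D_v f).
Proof.
move=> mf df.
pose h k : R := k.+1%:R^-1.
apply: (@measurable_fun_cvg _ _ _ D
  (fun k x => (h k)^-1 *: (f (h k *: v + x) - f x))) => [k|x Dx].
  apply: measurable_funTS; apply: measurable_funM => //.
  apply: measurable_funB => //; apply: (measurableT_comp mf).
  apply/measurable_fun_rVP => i.
  under eq_fun do rewrite !mxE.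
  by apply: measurable_funD => //; exact: measurable_coord.
have /cvgr_dnbhsP := df x Dx; apply; split.
  by move=> k; rewrite /h invr_neq0.
exact: cvg_harmonic.
Qed.

Lemma Lfun2_sqr_lty d (T : measurableType d) (R : realType)
    (P : probability T R) (X : T -> R) :
  measurable_fun [set: T] X -> ('E_P[fun x => (X x ^+ 2)%R] < +oo)%E ->
  X \in Lfun P 2%:E.
Proof.
move=> mX EX; rewrite inE; apply/andP; split; rewrite inE//=.
rewrite /finite_norm unlock; apply: poweR_lty.
move: EX; rewrite unlock; apply: le_lt_trans.
rewrite le_eqVlt; apply/orP; left; apply/eqP; apply: eq_integral => x _ /=.
by rewrite powR_mulrn// real_normK// num_real.
Qed.

(** * Integration against the law with density [q] *)

Section law_integral.
Local Open Scope ereal_scope.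
Context {R : realType} {n : nat} {Theta : set 'rV[R]_n} (q : density Theta).
Let mu := lebesgue_rV R n.

Lemma law_dominates : law q `<< mu.
Proof.
apply/null_content_dominatesP => A mA muA0.
have mT := density_measurable_support q.
apply: null_set_integral; first exact: measurableI.
- by apply/measurable_EFinP/measurable_funTS; exact: density_measurable.
- by apply/eqP; rewrite -measure_le0 -muA0 measureIl.
Qed.

Lemma integrable_density : mu.-integrable Theta (EFin \o q).
Proof.
apply/integrableP; split.
  by apply/measurable_EFinP/measurable_funTS; exact: density_measurable.
under eq_integral => x /[!inE] Tx.
  rewrite /= ger0_norm; last by rewrite ltW// density_gt0.
  over.
by rewrite density_integral1 ltry.
Qed.

(** Absolute continuity gives a change of variables with the Radon-Nikodym derivative, which is then
    identified with [q] almost everywhere on [Theta]. *)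
Lemma integral_law (f : 'rV[R]_n -> \bar R) :
    (law q).-integrable Theta f ->
  \int[law q]_(x in Theta) f x = \int[mu]_(x in Theta) (f x * (q x)%:E).
Proof.
move=> intf; have mT := density_measurable_support q.
rewrite -(Radon_Nikodym_change_of_variables law_dominates)//.
have mq : measurable_fun Theta (EFin \o q).
  exact: measurable_int integrable_density.
have mf : measurable_fun Theta f by exact: measurable_int intf.
set rn := Radon_Nikodym _ _.
have irn : mu.-integrable Theta rn.
  apply: (integrableS measurableT) => //.
  by apply: Radon_Nikodym_integrable; exact: law_dominates.
apply: ae_eq_integral => //.
- by apply: emeasurable_funM => //; exact: measurable_int irn.
- exact: emeasurable_funM.
(* Both densities integrate to [law q E] over every measurable [E] inside [Theta], hence agree
   almost everywhere there. *)
- apply: ae_eqe_mul2l; apply: integral_ae_eq => //= E ET mE.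
  rewrite -Radon_Nikodym_integral//=; last exact: law_dominates.
  by rewrite /law setIidl.
Qed.

End law_integral.

(** * Linear regression of a square-integrable [h] on [g] *)

Section control_variate.
Context {R : realType} {n : nat} (P : probability 'rV[R]_n R).
Variables (g : 'rV[R]_n -> 'cV[R]_n) (h : 'rV[R]_n -> R).
Hypothesis g2 : forall i, (fun x => g x i ord0) \in Lfun P 2%:E.
Hypothesis h2 : h \in Lfun P 2%:E.

Let lin (c : 'cV[R]_n) x := (c^T *m g x) ord0 ord0.

Let linE c : lin c = \sum_i (c i ord0 \o* (fun x => g x i ord0)).
Proof.
apply/funext => x; rewrite /lin mxE fct_sumE.
by apply: eq_bigr => i _; rewrite mxE mulrC.
Qed.

Let le12 : 1 <= 2 :> R.
Proof. by rewrite ler1n. Qed.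

Let Lfun21 (X : 'rV[R]_n -> R) : X \in Lfun P 2%:E -> X \in Lfun P 1.
Proof. by apply: Lfun_subset12; exact: fin_num_measure. Qed.

Lemma Lfun2_linear (c : 'cV[R]_n) :
  (fun x => (c^T *m g x) ord0 ord0) \in Lfun P 2%:E.
Proof.
by rewrite -/(lin c) linE rpred_sum// => i _; exact: Lfun_scale.
Qed.

Lemma expectation_linear (c : 'cV[R]_n) :
  (forall i, 'E_P[fun x => g x i ord0] = 0)%E ->
  ('E_P[fun x => ((c^T *m g x) ord0 ord0)%R] = 0)%E.
Proof.
move=> g0; pose F i : 'rV[R]_n -> R := c i ord0 \o* (fun x => g x i ord0).
rewrite -/(lin c) linE -(big_map F xpredT id).
rewrite expectation_sum => [|_ /mapP[i _ ->]].
  rewrite big_map big1// => i _; rewrite /F.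
  by rewrite expectationZl ?g0 ?mule0// Lfun21.
by apply: Lfun21; apply: Lfun_scale.
Qed.

Lemma covariance_linear (c : 'cV[R]_n) (Y : 'rV[R]_n -> R) :
  Y \in Lfun P 2%:E ->
  covariance P (fun x => (c^T *m g x) ord0 ord0) Y =
  ((c^T *m cov_vec P g Y) ord0 ord0)%:E.
Proof.
move=> Y2; rewrite -/(lin c) linE.
transitivity (\sum_i covariance P (c i ord0 \o* (fun x => g x i ord0)) Y)%E.
  elim: (index_enum _) => [|i s IH]; first by rewrite !big_nil covariance_cst_l.
  rewrite !big_cons covarianceDl ?IH//; first exact: Lfun_scale.
  by rewrite rpred_sum// => j _; exact: Lfun_scale.
rewrite mxE -sumEFin; apply: eq_bigr => i _; rewrite !mxE.
(* A product of two L2 functions is integrable, so the covariance is finite and [fine] in [cov_vec]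
   loses nothing. *)
have gY : (fun x => g x i ord0) * Y \in Lfun P 1 by exact: Lfun2_mul_Lfun1.
have g1 := Lfun21 (g2 i); have Y1 := Lfun21 Y2.
by rewrite covarianceZl// EFinM fineK// covariance_fin_num.
Qed.

Lemma cov_vec_linear (c : 'cV[R]_n) :
  cov_vec P g (fun x => (c^T *m g x) ord0 ord0) = cov_mx P g *m c.
Proof.
apply/colP => i; rewrite mxE covarianceC covariance_linear//= !mxE.
by apply: eq_bigr => j _; rewrite !mxE mulrC covarianceC.
Qed.

Hypothesis cov_unit : cov_mx P g \in unitmx.
Let v := cov_vec P g h.
Let c := invmx (cov_mx P g) *m v.

(** The variance is the quadratic form of the covariance matrix at [c]; the normal equation
    [cov_mx P g *m c = v] collapses it to [c^T *m v]. *)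
Lemma variance_regression :
  ('V_P[fun x => ((c^T *m g x) ord0 ord0)%R] =
   ((v^T *m invmx (cov_mx P g) *m v) ord0 ord0)%:E)%E.
Proof.
rewrite /variance covariance_linear; last exact: Lfun2_linear.
(* A 1 x 1 matrix equals its transpose, so [c^T *m v] may be read as [v^T *m c]. *)
rewrite cov_vec_linear mulKVmx// -[c^T *m v]trmxK trmx_mul trmxK mxE.
by rewrite mulmxA.
Qed.

Lemma variance_residual :
  ('V_P[fun x => (h x - (c^T *m g x) ord0 ord0)%R] =
   'V_P[h] - ((v^T *m invmx (cov_mx P g) *m v) ord0 ord0)%:E)%E.
Proof.
have l2 := Lfun2_linear c.
rewrite (varianceB h2 l2) variance_regression covarianceC covariance_linear//.
rewrite -/v -[c^T *m v]trmxK trmx_mul trmxK [(_ ^T) ord0 ord0]mxE mulmxA.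
(* All terms being finite, the cancellation of one copy of the form against the doubled covariance
   is done in the reals. *)
rewrite -(fineK (variance_fin_num h2)) -EFinD.
by congr EFin; rewrite mulr2n mulrDl mul1r opprD addrA addrK.
Qed.

End control_variate.

(** * Measurability, second moments and mean of the score *)

Section score.
Context {R : realType} {n : nat} {Theta : set 'rV[R]_n} (q : density Theta).
Hypothesis dq : forall x, Theta x -> differentiable (q : 'rV[R]_n -> R) x.
Let mT := density_measurable_support q.

Let scoreE j x : Theta x -> score q x j ord0 = gradient q x j ord0 / q x.
Proof.
move=> Tx; rewrite /score mem_set// !mxE derive_ln_comp//; first exact: dq.
exact: density_gt0.
Qed.

Let score0 j x : ~ Theta x -> score q x j ord0 = 0.
Proof. by move=> Tx; rewrite /score memNset// mxE. Qed.

Lemma measurable_score j :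
  measurable_fun [set: 'rV[R]_n] (fun x => score q x j ord0).
Proof.
pose G x := gradient (fun y => ln (q y)) x j ord0.
rewrite (_ : (fun _ => _) = G \_ Theta); last first.
  by apply/funext => x; rewrite patchE /score; case: ifP => // _; rewrite mxE.
apply/(measurable_restrictT _ mT); rewrite /G.
under eq_fun do rewrite mxE.
apply: measurable_fun_derive => [|x Tx].
  (* [ln] is total and measurable on the whole line, so the sign of [q] outside [Theta] is
     harmless. *)
  exact: measurableT_comp (@measurable_ln R) (density_measurable q).
by apply/diff_derivable/differentiable_ln_comp; [exact: dq|exact: density_gt0].
Qed.

Hypothesis score_sq : ('E_(law q)[(fun x => sqnorm2 (score q x))%R] < +oo)%E.

(** Each squared component is bounded by the squared Euclidean norm. *)
Lemma Lfun2_score j : (fun x => score q x j ord0) \in Lfun (law q) 2%:E.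
Proof.
have mscore2 i : measurable_fun setT (fun x => score q x i ord0 ^+ 2).
  by apply: measurable_funX; exact: measurable_score.
apply: Lfun2_sqr_lty; first exact: measurable_score.
apply: le_lt_trans score_sq; apply: expectation_le => //.
- exact: measurable_sum.
- by move=> x; exact: sqr_ge0.
- by move=> x; apply: sumr_ge0 => i _; exact: sqr_ge0.
apply: aeW => x; rewrite /sqnorm2 (bigD1 j)//= lerDl.
by apply: sumr_ge0 => i _; exact: sqr_ge0.
Qed.

(** On [Theta] the score is the gradient of [q] divided by [q]; integrating against the density
    cancels the denominator. *)
Lemma expectation_score j :
  ('E_(law q)[fun x => score q x j ord0] =
   \int[lebesgue_rV R n]_(x in Theta) (gradient q x j ord0)%:E)%E.
Proof.
have L1 : (fun x => score q x j ord0) \in Lfun (law q) 1.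
  by apply: Lfun_subset12 (Lfun2_score j); exact: fin_num_measure.
transitivity (\int[law q]_(x in Theta) (score q x j ord0)%:E)%E.
  (* The score vanishes off [Theta], so the expectation is an integral over [Theta] alone. *)
  rewrite unlock [RHS]integral_mkcond; apply: eq_integral => x _.
  rewrite patchE; case: ifPn => // /negP Tx; rewrite score0// => ?.
  by apply: Tx; exact: mem_set.
rewrite integral_law.
  apply: eq_integral => x /[!inE] Tx; rewrite -EFinM scoreE// divfK//.
  by rewrite gt_eqF// density_gt0.
apply: (integrableS measurableT) => //.
by move/Lfun1_integrable: L1.
Qed.

End score.

Theorem theorem4p1 (R : realType) (d n : nat) (Lambda : set 'rV[R]_d)
    (m : surrogate R d n)
    (t : nat) (t_gt0 : (0 < t)%N) (D : t.-tuple ('rV[R]_d * R))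
    (D_Lambda : forall i, Lambda (tnth D i).1)
    (lambda : 'rV[R]_d) (lambda_Lambda : Lambda lambda)
    (EI_real : forall theta, param_space m theta ->
      EI_ereal m D lambda theta \is a fin_num)
    (EI_measurable : measurable_fun (param_space m) (EI m D lambda))
    (q : density (param_space m))
    (q_differentiable : forall theta, param_space m theta ->
      differentiable (q : 'rV[R]_n -> R) theta)
    (q_int_gradient : forall j : 'I_n,
      (\int[lebesgue_rV R n]_(theta in param_space m)
        (gradient q theta j ord0)%:E = 0)%E)
    (EI_sq : ('E_(law q)[(fun theta => EI m D lambda theta ^+ 2)%R] < +oo)%E)
    (score_sq : ('E_(law q)[(fun theta => sqnorm2 (score q theta))%R] < +oo)%E)
    (Sigma_unit : cov_mx (law q) (score q) \in unitmx) :
  ('E_(law q)[EI_orth D lambda q] = EI_marg D lambda q)%E /\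
  ('V_(law q)[EI_orth D lambda q] =
     'V_(law q)[EI m D lambda] -
     (((cov_vec (law q) (score q) (EI m D lambda))^T
        *m invmx (cov_mx (law q) (score q))
        *m cov_vec (law q) (score q) (EI m D lambda)) ord0 ord0)%:E)%E /\
  ('V_(law q)[EI_orth D lambda q] <= 'V_(law q)[EI m D lambda])%E.
Proof.
have g2 j := Lfun2_score q_differentiable score_sq j.
have g0 j : ('E_(law q)[fun x => score q x j ord0] = 0)%E.
  by rewrite expectation_score.
have mT := density_measurable_support q.
have EI2 : EI m D lambda \in Lfun (law q) 2%:E.
  apply: Lfun2_sqr_lty EI_sq.
  (* [EI] is zero off the parameter space, so measurability there extends to the whole space. *)
  rewrite (_ : EI m D lambda = EI m D lambda \_ (param_space m)).
    exact/(measurable_restrictT _ mT).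
  by apply/funext => x; rewrite patchE /EI; case: ifP.
have S2 := Lfun2_linear g2 (EI_gamma D lambda q).
have L21 X : X \in Lfun (law q) 2%:E -> X \in Lfun (law q) 1.
  by apply: Lfun_subset12; exact: fin_num_measure.
have VS := variance_residual g2 EI2 Sigma_unit.
(* The variance identity is [VS] up to unfolding [EI_orth] and [EI_gamma]. *)
split; last split => //.
- rewrite (expectationB (L21 _ EI2) (L21 _ S2)).
  by rewrite (expectation_linear g2) ?sube0.
(* The subtracted form is turned back into the variance of the correction, hence is nonnegative. *)
- rewrite [leLHS]VS -(variance_regression (EI m D lambda) g2 Sigma_unit).
  by rewrite leeBlDr ?variance_fin_num// leeDl// variance_ge0.
Qed.
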